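(* The area of the circle (i.e. of the disc it bounds) with radius $r>0$ is $\pi r^2$.
   Context: Fix an integer $k\ge3$. For a circle of radius $r$ let $P_n^L$ and $P_n^U$ be the perimeters of the regular $2^nk$-gons respectively inscribed in and circumscribed about the circle, $n\ge0$. Here $\pi$ denotes the constant, independent of $r$, equal to the ratio of the area of a circle to the square of its radius, which is also the common value $\operatorname{LUB}(\{P_n^L/2r\})=\operatorname{GLB}(\{P_n^U/2r\})$, where LUB and GLB are the least upper bound and greatest lower bound. *)

(* Defs.v *)
From HB Require Import structures.
From mathcomp Require Export all_boot all_order all_algebra.
From mathcomp Require Export all_classical all_reals all_analysis.

Set Implicit Arguments.
Unset Strict Implicit.
Unset Printing Implicit Defensive.

Import Order.TTheory GRing.Theory Num.Theory.
Local Open Scope classical_set_scope.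
Local Open Scope ring_scope.

Section PlaneGeometry.
Context {R : realType}.
Implicit Types (a b c u v w : R * R) (r : R).

Definition dot u v : R := u.1 * v.1 + u.2 * v.2.

Definition cross u v : R := u.1 * v.2 - u.2 * v.1.

(* The library norm on [R * R] is the sup norm, hence an explicit Euclidean
   distance. *)
Definition edist u v : R := Num.sqrt (dot (u - v) (u - v)).

(* Convex angle at the vertex [v]. *)
Definition angle u v w : R :=
  acos (dot (u - v) (w - v) / (edist u v * edist w v)).

Definition line a b : set (R * R) :=
  [set p | exists t : R, p = a + t *: (b - a)].

Definition segment a b : set (R * R) :=
  [set p | exists2 t : R, 0 <= t <= 1 & p = a + t *: (b - a)].

Definition circle c r : set (R * R) := [set p | edist p c = r].

Definition disc c r : set (R * R) := [set p | edist p c <= r].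

Definition area (A : set (R * R)) : \bar R :=
  (lebesgue_measure \x lebesgue_measure)%E A.

(* A polygon is the cyclic family of its vertices; [ordS] is the cyclic
   successor on ['I_m]. *)
Definition polygon (m : nat) := 'I_m -> R * R.

Definition perimeter (m : nat) (V : polygon m) : R :=
  \sum_(i < m) edist (V i) (V (ordS i)).

(* Strictly convex, with the vertices listed counterclockwise: every vertex
   not on the side [V i, V (ordS i)] lies strictly to the left of it.  This
   rules out star polygons; every convex polygon has such a listing of its
   vertices, and the orientation of the listing does not affect the perimeter. *)
Definition convex_polygon (m : nat) (V : polygon m) : Prop :=
  forall i j : 'I_m, j != i -> j != ordS i ->
    0 < cross (V (ordS i) - V i) (V j - V i).

Definition equilateral (m : nat) (V : polygon m) : Prop :=
  forall i j : 'I_m, edist (V i) (V (ordS i)) = edist (V j) (V (ordS j)).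

Definition equiangular (m : nat) (V : polygon m) : Prop :=
  forall i j : 'I_m,
    angle (V i) (V (ordS i)) (V (ordS (ordS i))) =
    angle (V j) (V (ordS j)) (V (ordS (ordS j))).

Definition regular_polygon (m : nat) (V : polygon m) : Prop :=
  [/\ convex_polygon V, equilateral V & equiangular V].

Definition inscribed (m : nat) (V : polygon m) c r : Prop :=
  forall i : 'I_m, circle c r (V i).

(* The line carrying the side meets the circle in exactly one point, and this
   point of tangency belongs to the side. *)
Definition tangent_side a b c r : Prop :=
  exists2 p, segment a b p & line a b `&` circle c r = [set p].

Definition circumscribed (m : nat) (V : polygon m) c r : Prop :=
  forall i : 'I_m, tangent_side (V i) (V (ordS i)) c r.

(* { P_n^L / 2r | n >= 0 } *)
Definition inscribed_ratios (k : nat) c r : set R :=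
  [set q | exists (n : nat) (V : polygon (2 ^ n * k)),
     [/\ regular_polygon V, inscribed V c r & q = perimeter V / (2 * r)]].

(* { P_n^U / 2r | n >= 0 } *)
Definition circumscribed_ratios (k : nat) c r : set R :=
  [set q | exists (n : nat) (V : polygon (2 ^ n * k)),
     [/\ regular_polygon V, circumscribed V c r & q = perimeter V / (2 * r)]].

(* [p] is, simultaneously for all circles, the common value of the least upper
   bound of the inscribed ratios and of the greatest lower bound of the
   circumscribed ones.  There is at most one such [p]; [supremums] and
   [infimums] of an empty set of reals being empty, the existence of one
   entails that of regular inscribed and circumscribed polygons. *)
Definition circle_constant (k : nat) (p : R) : Prop :=
  forall c r, 0 < r ->
    supremums (inscribed_ratios k c r) p /\
    infimums (circumscribed_ratios k c r) p.

End PlaneGeometry.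

(* Main.v *)
(* The constant is the analytic [pi].  The vertices of a convex inscribed
   polygon have increasing polar angles over one turn, and a chord is shorter
   than its arc, so the perimeter is at most [2 pi r].  For a circumscribed
   polygon, convexity puts the centre to the left of every side; the polar
   angles of two consecutive points of tangency then differ by [2 atan u], where
   [r u] is the length of the tangents from their common vertex.  These
   differences add up to a positive multiple of [2 pi], and [atan u <= u], so
   the perimeter [2 r (sum of the u)] is at least [2 pi r].  The standard
   regular [m]-gons have ratios [m sin (pi / m)] and [m tan (pi / m)], which
   come arbitrarily close to [pi].  The area is obtained by integrating the
   lengths of vertical chords with the substitution [x = c.1 + r sin t]. *)

Require Import Defs.
From mathcomp Require Import measurable_realfun zify ring lra.
Import Order.TTheory GRing.Theory Num.Theory.
Import numFieldNormedType.Exports.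
Local Open Scope classical_set_scope.
Local Open Scope ring_scope.

Set Implicit Arguments.
Unset Strict Implicit.
Unset Printing Implicit Defensive.

(** * Trigonometric inequalities and angles of unit vectors *)

Section Trigonometry.
Context {R : realType}.
Implicit Types (a b x y t u : R).

Lemma sin_le x : 0 <= x -> sin x <= x.
Proof.
move=> x0; have [y _] := @MVT_segment R sin cos 0 x x0 (fun u _ => is_derive_sin u)
  (continuous_subspaceT (@continuous_sin R)).
by rewrite sin0 !subr0 => ->; rewrite ler_piMl// cos_le1.
Qed.

Lemma norm_sin_le x : `|sin x| <= `|x|.
Proof.
wlog x0 : x / 0 <= x => [hw|].
  have [/hw//|/ltW x0] := leP 0 x.
  by rewrite -[`|x|]normrN -[`|sin x|]normrN -sinN hw// oppr_ge0.
have [x1|x1] := leP x 1.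
  rewrite ger0_norm ?(ger0_norm x0) ?sin_le// sin_ge0_pi// x0 (le_trans x1)//.
  by rewrite (le_trans _ (pi_ge2 _))// ler1n.
by rewrite (le_trans (sin_max x))// ltW// (lt_le_trans x1)// ler_norm.
Qed.

Lemma cos_ge_1B x : 0 <= x -> 1 - x <= cos x.
Proof.
move=> x0.
have [y _] := @MVT_segment R cos (fun u => - sin u) 0 x x0 (fun u _ => is_derive_cos u)
  (continuous_subspaceT (@continuous_cos R)).
rewrite cos0 subr0 => h; have := sin_le1 y; nra.
Qed.

Lemma atan_le x : 0 <= x -> atan x <= x.
Proof.
move=> x0; have [y _] := @MVT_segment R atan (fun u => (1 + u ^+ 2)^-1) 0 x x0
  (fun u _ => is_derive1_atan u) (continuous_subspaceT (@continuous_atan R)).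
rewrite atan0 !subr0 => ->; rewrite ler_piMl// invf_le1 ?ltr_pwDl ?sqr_ge0//.
by rewrite lerDl sqr_ge0.
Qed.

(** This is [atan_le] at [tan x], multiplied by [cos x > 0]. With [cos_ge_1B] it yields
    [x * (1 - x) <= sin x], enough for the limit of the inscribed ratios. *)
Lemma mulr_cos_le_sin x : 0 <= x < pi / 2 -> x * cos x <= sin x.
Proof.
move=> /andP[x0 xpi]; have pi0 := @pi_gt0 R.
have c0 : 0 < cos x by apply: cos_gt0_pihalf; apply/andP; split; lra.
rewrite -ler_pdivlMr// -/(tan x) -[leLHS]tanK; last by rewrite in_itv/=; lra.
apply: atan_le; rewrite divr_ge0 ?(ltW c0)// sin_ge0_pi//; lra.
Qed.

Lemma cos_double_atan t : (1 + t ^+ 2) * cos (atan t *+ 2) = 1 - t ^+ 2.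
Proof.
have q0 : 0 < 1 + t ^+ 2 by rewrite ltr_pwDl ?sqr_ge0.
rewrite cos_mulr2n cos_atan exprVn sqr_sqrtr ?ltW//.
by field; rewrite gt_eqF//.
Qed.

Lemma sin_double_atan t : (1 + t ^+ 2) * sin (atan t *+ 2) = t *+ 2.
Proof.
have q0 : 0 < 1 + t ^+ 2 by rewrite ltr_pwDl ?sqr_ge0.
have c0 : cos (atan t) != 0 by rewrite cos_atan invr_eq0 sqrtr_eq0 -ltNge.
have s : sin (atan t) = t * cos (atan t) by rewrite -{2}(atanK t) /tan divfK.
rewrite sin_mulr2n s mulrCA -expr2 cos_atan exprVn sqr_sqrtr ?ltW//.
by field; rewrite gt_eqF//.
Qed.

(** For [0 < x < 2 pi] one has [sin (x / 2) > 0], so [cos x = 1 - 2 sin (x / 2) ^ 2] is below 1.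
    This later bounds a total turn from below without counting revolutions. *)
Lemma cos_eq1_ge x : 0 < x -> cos x = 1 -> pi *+ 2 <= x.
Proof.
move=> x0 cx; rewrite leNgt; apply/negP => xpi.
have s0 : 0 < sin (x / 2) by apply: sin_gt0_pi; apply/andP; split; lra.
have : cos (x / 2 *+ 2) = 1 by rewrite -[RHS]cx; congr cos; lra.
rewrite cos_mulr2n cos2sin2; have := exprn_gt0 2 s0; lra.
Qed.

(** The left side is twice the signed area of a triangle inscribed in the unit circle with
    successive arcs [2 x] and [2 y]; the product form makes its sign readable. *)
Lemma sinD_sub x y :
  sin (x *+ 2) + sin (y *+ 2) - sin ((x + y) *+ 2) = 4 * sin x * sin y * sin (x + y).
Proof.
rewrite !sin_mulr2n cosD sinD.
(* Factors equal to 1 make every term quadratic in the functions of [x] and in those of [y], so that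
   [ring] can conclude. *)
have -> : (cos x * sin x) *+ 2 = (cos x * sin x) * (cos y ^+ 2 + sin y ^+ 2) *+ 2.
  by rewrite cos2Dsin2 mulr1.
have -> : (cos y * sin y) *+ 2 = (cos y * sin y) * (cos x ^+ 2 + sin x ^+ 2) *+ 2.
  by rewrite cos2Dsin2 mulr1.
ring.
Qed.

Lemma polar_unit x y : x ^+ 2 + y ^+ 2 = 1 ->
  exists2 t, 0 <= t < pi *+ 2 & x = cos t /\ y = sin t.
Proof.
move=> xy1; have pi0 := @pi_gt0 R.
have x1 : -1 <= x <= 1.
  rewrite -ler_norml -(expr_le1 (n := 2))// real_normK ?num_real//.
  by have := sqr_ge0 y; lra.
have sE : sin (acos x) = `|y|.
  by rewrite sin_acos// -sqrtr_sqr; congr Num.sqrt; lra.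
have [y0|y0] := leP 0 y.
  exists (acos x); last by rewrite acosK// sE ger0_norm.
  rewrite acos_ge0//= (le_lt_trans (acos_lepi x1))//; lra.
exists (pi *+ 2 - acos x).
  (* As [y < 0] excludes [x = 1], [acos x] is positive and the angle stays strictly below a full
     turn. *)
  have x2 : -1 <= x < 1 by case/andP: x1 => -> _ /=; nra.
  have := acos_gt0 x2; have := acos_lepi x1 => h1 h2; apply/andP; split; lra.
rewrite addrC cosD2pi sinD2pi cosN sinN acosK// sE ltr0_norm//; lra.
Qed.

(** Rotate the point by [- t0] and apply [polar_unit]. A free angular origin allows measuring angles
    from a chosen vertex. *)
Lemma polar_unit_from t0 x y : x ^+ 2 + y ^+ 2 = 1 ->
  exists2 t, t0 <= t < t0 + pi *+ 2 & x = cos t /\ y = sin t.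
Proof.
move=> xy1; have cs := cos2Dsin2 t0.
have [|t tpi [ct st]] := @polar_unit (x * cos t0 + y * sin t0) (y * cos t0 - x * sin t0).
  by rewrite -[RHS](mulr1 1) -{1}xy1 -cs; ring.
exists (t0 + t).
  by rewrite lerDl ltrD2l.
rewrite cosD sinD -ct -st; split.
  transitivity (x * (cos t0 ^+ 2 + sin t0 ^+ 2)); first by rewrite cs mulr1.
  ring.
transitivity (y * (cos t0 ^+ 2 + sin t0 ^+ 2)); first by rewrite cs mulr1.
ring.
Qed.
End Trigonometry.

(** * Polar coordinates, chords and inscribed triangles *)

Section Polar.
Context {R : realType}.
Implicit Types (c : R * R) (r s t : R).

Definition polar c r t : R * R := (c.1 + r * cos t, c.2 + r * sin t).

Lemma circle_polar c r t : 0 <= r -> circle c r (polar c r t).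
Proof.
move=> r0; rewrite /circle/= /edist /dot /=.
rewrite -[RHS]ger0_norm// -[RHS]sqrtr_sqr; congr Num.sqrt.
by rewrite -[RHS]mulr1 -(cos2Dsin2 t); ring.
Qed.

Lemma circle_polar_from c r t0 (p : R * R) : 0 < r -> circle c r p ->
  exists2 t, t0 <= t < t0 + pi *+ 2 & p = polar c r t.
Proof.
rewrite /circle/= /edist /dot /= => r0 pE.
have E : (p.1 - c.1) ^+ 2 + (p.2 - c.2) ^+ 2 = r ^+ 2.
  by rewrite -pE sqr_sqrtr// -!expr2 addr_ge0 ?sqr_ge0.
have [|t ht [x y]] := @polar_unit_from R t0 ((p.1 - c.1) / r) ((p.2 - c.2) / r).
  by rewrite !expr_div_n -mulrDl E divff// expf_neq0// gt_eqF.
exists t => //; rewrite /polar -x -y.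
case: (p) => p1 p2 /=; congr pair; field; rewrite gt_eqF//.
Qed.

Lemma polarD2pi c r t : polar c r (t + pi *+ 2) = polar c r t.
Proof. by rewrite /polar cosD2pi sinD2pi. Qed.

Lemma edist_polar c r s t : 0 <= r ->
  edist (polar c r s) (polar c r t) = 2 * r * `|sin ((t - s) / 2)|.
Proof.
move=> r0; have -> : 2 * r = `|2 * r| by rewrite ger0_norm// mulr_ge0.
rewrite -normrM -sqrtr_sqr /edist; congr Num.sqrt.
have -> : (2 * r * sin ((t - s) / 2)) ^+ 2 = r ^+ 2 * (2 - 2 * cos (t - s)).
  have -> : cos (t - s) = 1 - 2 * sin ((t - s) / 2) ^+ 2.
    have {1}-> : t - s = (t - s) / 2 *+ 2 by lra.
    by rewrite cos_mulr2n cos2sin2; ring.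
  ring.
rewrite cosB /dot /polar /=.
have := cos2Dsin2 s; have := cos2Dsin2 t.
set a := cos s; set b := sin s; set a' := cos t; set b' := sin t => h1 h2.
transitivity (r ^+ 2 * ((a ^+ 2 + b ^+ 2) + (a' ^+ 2 + b' ^+ 2) - 2 * (a' * a + b' * b))).
  ring.
by rewrite h1 h2; ring.
Qed.

Lemma cross_polar c r a b d :
  cross (polar c r b - polar c r a) (polar c r d - polar c r a) =
  4 * r ^+ 2 * sin ((b - a) / 2) * sin ((d - b) / 2) * sin ((d - a) / 2).
Proof.
have -> : (d - a) / 2 = (b - a) / 2 + (d - b) / 2 by lra.
transitivity (r ^+ 2 * (4 * sin ((b - a) / 2) * sin ((d - b) / 2) *
  sin ((b - a) / 2 + (d - b) / 2))); last by ring.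
rewrite -sinD_sub.
have -> : (b - a) / 2 *+ 2 = b - a by lra.
have -> : (d - b) / 2 *+ 2 = d - b by lra.
have -> : ((b - a) / 2 + (d - b) / 2) *+ 2 = d - a by lra.
by rewrite !sinB /cross /polar /=; ring.
Qed.
End Polar.

(** * Inscribed polygons and the standard regular polygon *)

Section Inscribed.
Context {R : realType}.
Implicit Types (c : R * R) (r s t : R).

Lemma edist_polar_le c r s t : 0 <= r -> s <= t ->
  edist (polar c r s) (polar c r t) <= r * (t - s).
Proof.
move=> r0 st; rewrite edist_polar//.
have := norm_sin_le ((t - s) / 2); rewrite [`|(t - s) / 2|]ger0_norm; last by lra.
nra.
Qed.

Lemma perimeter_inscribed_le m (V : polygon m) c r : 0 < r ->
  convex_polygon V -> inscribed V c r -> perimeter V <= 2 * pi * r.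
Proof.
move=> r0; have pi0 := @pi_gt0 R; case: m V => [|m] V cvxV insV.
  by rewrite /perimeter big_ord0 !mulr_ge0 ?pi_ge0// ltW.
have [t0 _ V0] := circle_polar_from 0 r0 (insV ord0).
have /choice[a aP] (i : 'I_m.+1) :
    exists t, [/\ i = ord0 -> t = t0, t0 <= t < t0 + pi *+ 2 & V i = polar c r t].
  have [->|i0] := eqVneq i ord0; first by exists t0; split=> //; lra.
  have [t tP Vi] := circle_polar_from t0 r0 (insV i).
  by exists t; split=> // ie; rewrite ie eqxx in i0.
(* The extra value [f m.+1], one full turn after the start, stands for the first vertex reached
   again; the closing side then obeys the same bound and the sum telescopes to [2 pi]. *)
pose f n := if (n <= m)%N then a (inord n) else t0 + pi *+ 2.
have a0 : a ord0 = t0 by have [->] := aP ord0.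
have side (i : 'I_m.+1) : edist (V i) (V (ordS i)) <= r * (f i.+1 - f i).
  have im : (i <= m)%N by rewrite -ltnS.
  have -> : f i = a i by rewrite /f im inord_val.
  have [_ ai Vi] := aP i.
  move: im; rewrite leq_eqVlt => /orP[/eqP im|im].
    have -> : ordS i = ord0 by apply/val_inj; rewrite /= im modnn.
    have -> : f i.+1 = t0 + pi *+ 2 by rewrite /f im ltnn.
    rewrite V0 -polarD2pi Vi; apply: edist_polar_le; [lra|].
    by case/andP: ai => _ /ltW.
  have Si : f i.+1 = a (ordS i).
    rewrite /f im; congr a; apply/val_inj; rewrite /= inordK ?ltnS//.
    by rewrite modn_small ?ltnS.
  have [_ aSi VSi] := aP (ordS i).
  rewrite Si Vi VSi; apply: edist_polar_le; first exact: ltW.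
  have [i0|i0] := eqVneq i ord0; first by move: aSi; rewrite i0 a0 => /andP[].
  (* Vertex 0 lies strictly to the left of side [i]. Were the angle to decrease along that side, all
     three sines in [cross_polar] would be nonpositive, and so would the cross product. *)
  have := cvxV i ord0; rewrite eq_sym i0 => /(_ isT).
  have -> : ord0 != ordS i.
    by apply/eqP => /(congr1 val) /=; rewrite modn_small ?ltnS.
  move=> /(_ isT); rewrite V0 Vi VSi cross_polar; apply: contraTle => lt_a.
  have s1 : 0 <= sin ((a i - a (ordS i)) / 2).
    by apply: sin_ge0_pi; apply/andP; split; lra.
  have s2 : 0 <= sin ((a (ordS i) - t0) / 2).
    by apply: sin_ge0_pi; apply/andP; split; lra.
  have s3 : 0 <= sin ((a i - t0) / 2).
    by apply: sin_ge0_pi; apply/andP; split; lra.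
  rewrite -leNgt.
  have -> : (a (ordS i) - a i) / 2 = - ((a i - a (ordS i)) / 2) by lra.
  have -> : (t0 - a (ordS i)) / 2 = - ((a (ordS i) - t0) / 2) by lra.
  have -> : (t0 - a i) / 2 = - ((a i - t0) / 2) by lra.
  rewrite !sinN !(mulrN, mulNr) !opprK oppr_le0.
  by rewrite !mulr_ge0 ?(ltW r0)//.
apply: (le_trans (ler_sum _ (fun i _ => side i))).
rewrite -mulr_sumr -(big_mkord predT (fun i => f i.+1 - f i)) telescope_sumr//.
rewrite /f ltnn /=.
have -> : inord 0 = ord0 :> 'I_m.+1 by apply/val_inj; rewrite /= inordK.
rewrite a0 le_eqVlt; apply/orP; left; apply/eqP; ring.
Qed.

Definition ngon m c r : polygon m := fun i => polar c r (pi / m%:R *+ 2 * i%:R).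

(** At the last vertex the wrap-around of the index is absorbed by the period [2 pi], so later
    computations need no modular arithmetic. *)
Lemma ngon_ordS m c r (i : 'I_m) :
  ngon c r (ordS i) = polar c r (pi / m%:R *+ 2 * i%:R + pi / m%:R *+ 2).
Proof.
have m0 : m%:R != 0 :> R by rewrite pnatr_eq0 -lt0n (leq_ltn_trans _ (ltn_ord i)).
have -> : pi / m%:R *+ 2 * i%:R + pi / m%:R *+ 2 = pi / m%:R *+ 2 * i.+1%:R :> R.
  by rewrite -[in RHS]natr1 mulrDr mulr1.
have := ltn_ord i; rewrite leq_eqVlt => /orP[/eqP Si|Si]; last first.
  by rewrite /ngon /= modn_small.
rewrite Si /ngon /= Si modnn mulr0 -polarD2pi add0r; congr polar.
by field.
Qed.

Lemma edist_ngon m c r (i : 'I_m) : 0 <= r ->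
  edist (ngon c r i) (ngon c r (ordS i)) = 2 * r * `|sin (pi / m%:R)|.
Proof.
move=> r0; rewrite ngon_ordS /ngon edist_polar//; congr (_ * `|sin _|); lra.
Qed.

Lemma perimeter_ngon m c r : (0 < m)%N -> 0 <= r ->
  perimeter (@ngon m c r) = 2 * r * (m%:R * sin (pi / m%:R)).
Proof.
move=> m0 r0; rewrite /perimeter (eq_bigr _ (fun i _ => edist_ngon c i r0)).
rewrite sumr_const card_ord ger0_norm; last first.
  apply: sin_ge0_pi; rewrite divr_ge0 ?pi_ge0//=.
  by rewrite ler_pdivrMr ?ltr0n// ler_peMr ?pi_ge0// ler1n.
by rewrite -[LHS]mulr_natr; ring.
Qed.

Lemma regular_ngon m c r : (0 < m)%N -> 0 < r -> regular_polygon (@ngon m c r).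
Proof.
move=> m0 r0; have pi0 := @pi_gt0 R; set h : R := pi / m%:R.
have h0 : 0 < h by rewrite divr_gt0 ?ltr0n.
have mh : m%:R * h = pi by rewrite mulrC divfK// pnatr_eq0 -lt0n.
split.
(* The sign is that of [sin h * sin (h (j - i - 1)) * sin (h (j - i))]. For [j > i + 1] all three
   angles lie in [(0, pi)]; for [j < i] the last two lie in [(- pi, 0)] and their signs cancel. *)
- move=> i j ji jSi; rewrite ngon_ordS /ngon cross_polar -/h.
  have -> : (h *+ 2 * i%:R + h *+ 2 - h *+ 2 * i%:R) / 2 = h by lra.
  have jm : j%:R + 1 <= m%:R :> R by rewrite natr1 ler_nat.
  have im : i%:R + 1 <= m%:R :> R by rewrite natr1 ler_nat.
  have i0 : 0 <= i%:R :> R by []. have j0 : 0 <= j%:R :> R by [].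
  have -> : (h *+ 2 * j%:R - (h *+ 2 * i%:R + h *+ 2)) / 2 = h * (j%:R - i%:R - 1) by lra.
  have -> : (h *+ 2 * j%:R - h *+ 2 * i%:R) / 2 = h * (j%:R - i%:R) by lra.
  have jSi' : (j : nat) != (i.+1 %% m)%N by [].
  have [lt_ij|le_ji] := ltnP i j.
    have lt_Sij : (i.+1 < j)%N.
      rewrite ltn_neqAle lt_ij andbT eq_sym; apply: contraNneq jSi' => ->.
      by rewrite modn_small// (leq_ltn_trans lt_ij).
    have ij : i%:R + 2 <= j%:R :> R by rewrite -natrD ler_nat addn2.
    rewrite !mulr_gt0 ?exprn_gt0// ?ltr0n//; apply: sin_gt0_pi; apply/andP; split; nra.
  have lt_ji : (j < i)%N by rewrite ltn_neqAle le_ji andbT.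
  have ij : j%:R + 1 <= i%:R :> R by rewrite natr1 ler_nat.
  (* The bound could fail only for [i = m - 1] and [j = 0], but then [j] is the successor of [i]. *)
  have ij' : i%:R - j%:R + 1 < m%:R :> R.
    have [Sim|Sim] := ltnP i.+1 m.
      by have : i%:R + 2 <= m%:R :> R; [rewrite -natrD ler_nat addn2|lra].
    have Em : i.+1 = m by apply/eqP; rewrite eqn_leq Sim (ltn_ord i).
    have : j != 0%N :> nat by move: jSi'; rewrite Em modnn.
    by rewrite -lt0n -(ler_nat R); lra.
  rewrite -mulrA -[X in _ * X]mulrNN -!sinN.
  rewrite !mulr_gt0 ?exprn_gt0// ?ltr0n//; apply: sin_gt0_pi; apply/andP; split; nra.
- by move=> i j; rewrite !edist_ngon// ltW.
- move=> i j; rewrite /angle.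
  have E (k : 'I_m) : edist (ngon c r k) (ngon c r (ordS k)) = 2 * r * `|sin h|.
    by rewrite edist_ngon// ltW.
  have E' (k : 'I_m) : edist (ngon c r (ordS k)) (ngon c r k) = 2 * r * `|sin h|.
    by rewrite -(E k) /edist /dot /=; congr Num.sqrt; ring.
  (* By rotation invariance [k] enters only through [cos u ^ 2 + sin u ^ 2], so the value is the
     same at every vertex. *)
  have D (k : 'I_m) : dot (ngon c r k - ngon c r (ordS k))
      (ngon c r (ordS (ordS k)) - ngon c r (ordS k)) =
      r ^+ 2 * (1 - 2 * cos (h *+ 2) + cos (h *+ 2 *+ 2)).
    have -> : ngon c r (ordS (ordS k)) =
        polar c r (h *+ 2 * k%:R + h *+ 2 + h *+ 2).
      have [Sk|Sk] := ltnP k.+1 m.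
        rewrite ngon_ordS -/h /= modn_small//; congr polar.
        by rewrite -natr1; ring.
      have Em : k.+1 = m by apply/eqP; rewrite eqn_leq Sk (ltn_ord k).
      rewrite ngon_ordS -/h /= Em modnn -polarD2pi; congr polar.
      have Em' : m%:R = k%:R + 1 :> R by rewrite natr1 Em.
      by rewrite -mh Em'; ring.
    rewrite ngon_ordS /ngon -/h /dot /polar /=.
    set u := h *+ 2 * k%:R; set d := h *+ 2.
    have -> : u + d + d = u + d *+ 2 by ring.
    rewrite [cos (u + d *+ 2)]cosD [sin (u + d *+ 2)]sinD.
    rewrite [cos (u + d)]cosD [sin (u + d)]sinD.
    rewrite sin_mulr2n cos_mulr2n.
    transitivity ((cos u ^+ 2 + sin u ^+ 2) * r ^+ 2 *
      (cos d ^+ 2 *+ 2 - 1 - cos d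
       - (cos d * (cos d ^+ 2 *+ 2 - 1) + 2 * cos d * sin d ^+ 2)
       + cos d ^+ 2 + sin d ^+ 2)).
      by ring.
    by rewrite cos2Dsin2 sin2cos2; ring.
  by rewrite !D !E !E'.
Qed.

Lemma inscribed_ngon m c r : 0 < r -> inscribed (@ngon m c r) c r.
Proof. by move=> r0 i; apply: circle_polar; exact: ltW. Qed.
End Inscribed.

(** * Tangent lines and circumscribed polygons *)

Section Circumscribed.
Context {R : realType}.
Implicit Types (a b c d : R * R) (r s t u : R).

(* The point at signed distance [r * s] from [polar c r t] on the tangent
   there. *)
Definition tangent_point c r t s : R * R :=
  (c.1 + r * (cos t - s * sin t), c.2 + r * (sin t + s * cos t)).

Lemma edist_tangent_points c r t s u : 0 <= r ->
  edist (tangent_point c r t s) (tangent_point c r t u) = r * `|u - s|.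
Proof.
move=> r0; rewrite -[in RHS](ger0_norm r0) -normrM -sqrtr_sqr /edist; congr Num.sqrt.
rewrite /dot /=; transitivity ((cos t ^+ 2 + sin t ^+ 2) * (r * (u - s)) ^+ 2).
  ring.
by rewrite cos2Dsin2 mul1r.
Qed.

Lemma edist_tangent_point_center c r t s :
  edist (tangent_point c r t s) c ^+ 2 = r ^+ 2 * (1 + s ^+ 2).
Proof.
rewrite /edist /dot /= sqr_sqrtr -?expr2 ?addr_ge0 ?sqr_ge0//.
transitivity ((cos t ^+ 2 + sin t ^+ 2) * (r ^+ 2 * (1 + s ^+ 2))); first by ring.
by rewrite cos2Dsin2 mul1r.
Qed.

Lemma tangent_side_points a b c r : 0 < r -> a != b -> tangent_side a b c r ->
  exists t s u, [/\ a = tangent_point c r t (- s), b = tangent_point c r t u &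
    (0 <= s /\ 0 <= u) \/ (s <= 0 /\ u <= 0)].
Proof.
move=> r0 ab [p [x /andP[x0 x1] px] tang].
have [_ pc] : (line a b `&` circle c r) p by rewrite tang.
have [t _ pt] := circle_polar_from 0 r0 pc.
have D0 : 0 < (b.1 - a.1) ^+ 2 + (b.2 - a.2) ^+ 2.
  rewrite lt_neqAle addr_ge0 ?sqr_ge0// andbT eq_sym paddr_eq0 ?sqr_ge0//.
  rewrite !sqrf_eq0 !subr_eq0; apply: contra ab => /andP[/eqP e1 /eqP e2].
  by rewrite [a]surjective_pairing [b]surjective_pairing e1 e2.
(* The reflection of [p] in the foot of the perpendicular from the centre is
   again on the line and on the circle, hence equal to [p]. *)
have orth : (b.1 - a.1) * cos t + (b.2 - a.2) * sin t = 0.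
  set o := LHS; pose y := - 2 * r * o / ((b.1 - a.1) ^+ 2 + (b.2 - a.2) ^+ 2).
  have : (line a b `&` circle c r) (p + y *: (b - a)).
    split; first by exists (x + y); rewrite px scalerDl addrA.
    rewrite /circle/= -[RHS]pc /edist; congr Num.sqrt.
    rewrite pt /dot /= /GRing.scale /=.
    transitivity (r ^+ 2 * (cos t ^+ 2 + sin t ^+ 2)
       + y * (2 * r * o + y * ((b.1 - a.1) ^+ 2 + (b.2 - a.2) ^+ 2))).
      rewrite /o; ring.
    have -> : y * ((b.1 - a.1) ^+ 2 + (b.2 - a.2) ^+ 2) = - 2 * r * o.
      by rewrite /y divfK// gt_eqF.
    ring.
  rewrite tang /= => yp.
  have yD : y * ((b.1 - a.1) ^+ 2 + (b.2 - a.2) ^+ 2) = 0.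
    have := congr1 fst yp; have := congr1 snd yp; rewrite /= /GRing.scale /= => h2 h1.
    have {}h1 : y * (b.1 - a.1) = 0 by lra.
    have {}h2 : y * (b.2 - a.2) = 0 by lra.
    by rewrite mulrDr !expr2 !mulrA h1 h2 !mul0r addr0.
  have : - 2 * r * o = 0 by rewrite -yD /y divfK// gt_eqF.
  move/eqP; rewrite !mulf_eq0 oppr_eq0 pnatr_eq0/= (gt_eqF r0)/=.
  by move/eqP.
(* The signed length of the side in units of [r], along the counterclockwise tangent direction; it
   is positive when the centre is on the left. *)
set l := ((b.2 - a.2) * cos t - (b.1 - a.1) * sin t) / r.
have cs := cos2Dsin2 t.
have b1 : b.1 - a.1 = - (r * l * sin t).
  rewrite /l mulrCA divff ?gt_eqF// mulr1.
  transitivity ((b.1 - a.1) * (cos t ^+ 2 + sin t ^+ 2)); first by rewrite cs mulr1.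
  transitivity (((b.1 - a.1) * cos t + (b.2 - a.2) * sin t) * cos t
    - ((b.2 - a.2) * cos t - (b.1 - a.1) * sin t) * sin t); first ring.
  by rewrite orth mul0r add0r.
have b2 : b.2 - a.2 = r * l * cos t.
  rewrite /l mulrCA divff ?gt_eqF// mulr1.
  transitivity ((b.2 - a.2) * (cos t ^+ 2 + sin t ^+ 2)); first by rewrite cs mulr1.
  transitivity (((b.1 - a.1) * cos t + (b.2 - a.2) * sin t) * sin t
    + ((b.2 - a.2) * cos t - (b.1 - a.1) * sin t) * cos t); first ring.
  by rewrite orth mul0r add0r.
have [p1 p2] : c.1 + r * cos t = a.1 + x * (b.1 - a.1) /\
    c.2 + r * sin t = a.2 + x * (b.2 - a.2).
  by move: px; rewrite pt => /[dup] /(congr1 fst) /= -> /(congr1 snd) /= ->.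
(* The contact point, at parameter [x] of the side, cuts [l] into two parts, neither of sign
   opposite to [l]. *)
exists t, (x * l), ((1 - x) * l); split.
- rewrite [LHS]surjective_pairing /tangent_point; congr pair.
    by move: p1; rewrite b1; lra.
  by move: p2; rewrite b2; lra.
- rewrite [LHS]surjective_pairing /tangent_point; congr pair.
    by move: p1; rewrite b1; lra.
  by move: p2; rewrite b2; lra.
- have [l0|/ltW l0] := leP 0 l; [left|right]; split; nra.
Qed.

(* If the centre were to the right of a side, the next vertex [d] would lie
   strictly beyond the line of that side, as seen from the centre, and the
   following side could not touch the circle. *)
Lemma tangent_points_ge0 c r t s u t' s' u' d : 0 < r ->
  tangent_point c r t u = tangent_point c r t' (- s') ->
  d = tangent_point c r t' u' ->
  (0 <= s /\ 0 <= u) \/ (s <= 0 /\ u <= 0) ->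
  (0 <= s' /\ 0 <= u') \/ (s' <= 0 /\ u' <= 0) ->
  0 < cross (tangent_point c r t u - tangent_point c r t (- s))
            (d - tangent_point c r t (- s)) ->
  [/\ 0 <= s, 0 <= u & 0 < s + u].
Proof.
move=> r0 eu -> su su' crs.
(* The last factor is 1 minus the projection of [d], in units of [r], on the direction of the first
   contact point: it is positive when [d] is on the centre's side of the tangent line. *)
have E : cross (tangent_point c r t u - tangent_point c r t (- s))
    (tangent_point c r t' u' - tangent_point c r t (- s)) =
    r ^+ 2 * (s + u) * (1 - (cos (t' - t) - u' * sin (t' - t))).
  rewrite cosB sinB /cross /tangent_point /=.
  transitivity (r ^+ 2 * (s + u) * (cos t ^+ 2 + sin t ^+ 2 -
    (cos t' * cos t + sin t' * sin t - u' * (sin t' * cos t - cos t' * sin t)))); first ring.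
  by rewrite cos2Dsin2.
(* The common vertex lies on the first tangent line, so its projection on the same direction is
   exactly 1. *)
have B : cos (t' - t) + s' * sin (t' - t) = 1.
  rewrite -[RHS](cos2Dsin2 t).
  have [] := (congr1 fst eu, congr1 snd eu); rewrite /tangent_point /= => h1 h2.
  have {}h1 : cos t - u * sin t = cos t' + s' * sin t'.
    apply: (mulfI (lt0r_neq0 r0)); lra.
  have {}h2 : sin t + u * cos t = sin t' - s' * cos t'.
    apply: (mulfI (lt0r_neq0 r0)); lra.
  rewrite cosB sinB.
  transitivity ((cos t' + s' * sin t') * cos t +
    (sin t' - s' * cos t') * sin t).
    ring.
  by rewrite -h1 -h2; ring.
have cs := cos2Dsin2 (t' - t); have c1 := cos_le1 (t' - t).
move: crs; rewrite E -mulrA pmulr_rgt0 ?exprn_gt0// => pos.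
have su0 : s + u != 0 by apply: contraTneq pos => ->; rewrite mul0r ltxx.
case: su => [[s0 u0]|[s0 u0]].
  by split=> //; rewrite lt_neqAle eq_sym su0 addr_ge0.
exfalso.
have lt1 : 1 < cos (t' - t) - u' * sin (t' - t).
  have : s + u < 0 by rewrite lt_neqAle su0; lra.
  by move=> neg; move: pos; rewrite nmulr_rgt0// subr_lt0.
set S := sin _ in cs B lt1 pos; set C := cos _ in cs c1 B lt1 pos.
have C1 : C < 1.
  rewrite lt_neqAle c1 andbT; apply/eqP => C1.
  have : S ^+ 2 = 0 by move: cs; rewrite C1; lra.
  by move/eqP; rewrite sqrf_eq0 => /eqP S0; move: lt1; rewrite S0 C1; lra.
(* Hence [s'] and [u'] have strictly opposite signs, although the contact point lies between the
   ends of its side. *)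
have h1 : 0 < s' * S by lra.
have h2 : u' * S < 0 by lra.
by case: su' => -[s'0 u'0]; have [S0|S0] := leP 0 S; nra.
Qed.

(** The two contact points are mirror images in the line from the centre to the common vertex, each
    at angle [atan u] from it. Angles are determined only modulo [2 pi], hence the equations between
    cosines and sines. *)
Lemma tangent_point_next c r t u t' : 0 < r ->
  tangent_point c r t u = tangent_point c r t' (- u) ->
  cos t' = cos (t + atan u *+ 2) /\ sin t' = sin (t + atan u *+ 2).
Proof.
move=> r0 eu; have q0 : 1 + u ^+ 2 != 0 by rewrite gt_eqF// ltr_pwDl ?sqr_ge0.
have [] := (congr1 fst eu, congr1 snd eu); rewrite /tangent_point /= => h1 h2.
have {}h1 : cos t - u * sin t = cos t' + u * sin t'.
  apply: (mulfI (lt0r_neq0 r0)); lra.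
have {}h2 : sin t + u * cos t = sin t' - u * cos t'.
  apply: (mulfI (lt0r_neq0 r0)); lra.
split; apply: (mulfI q0).
  rewrite cosD mulrBr ![(1 + u ^+ 2) * (_ * _)]mulrCA cos_double_atan sin_double_atan.
  transitivity ((cos t' + u * sin t') - u * (sin t' - u * cos t')); first by ring.
  by rewrite -h1 -h2; ring.
rewrite sinD mulrDr ![(1 + u ^+ 2) * (_ * _)]mulrCA cos_double_atan sin_double_atan.
transitivity ((sin t' - u * cos t') + u * (cos t' + u * sin t')); first by ring.
by rewrite -h1 -h2; ring.
Qed.

Lemma iter_ordS m n : iter n (@ordS m.+1) ord0 = (n %% m.+1)%N :> nat.
Proof. by elim: n => [|n IH] /=; rewrite ?mod0n// IH -addn1 modnDml addn1. Qed.

Lemma le_perimeter_circumscribed m (V : polygon m) c r : (3 <= m)%N -> 0 < r ->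
  convex_polygon V -> circumscribed V c r -> 2 * pi * r <= perimeter V.
Proof.
case: m V => // m V m3 r0 cvxV cirV; have pi0 := @pi_gt0 R.
(* Since there are at least three vertices, [i] and its next two successors are distinct, and
   convexity gives a strict left turn there. *)
have neq1 (i : 'I_m.+1) : ordS i != i.
  apply/eqP => /(congr1 val) /=.
  have := ltn_ord i; rewrite leq_eqVlt => /orP[/eqP e|h].
    by rewrite e modnn => e'; move: e m3; rewrite -e' => -[<-].
  by rewrite modn_small// => /eqP; rewrite eqn_leq ltnn.
have neq2 (i : 'I_m.+1) : ordS (ordS i) != i.
  apply/eqP => /(congr1 val) /=; rewrite -addn1 modnDml addn1.
  have [h|h] := ltnP i.+2 m.+1.
    by rewrite modn_small// => /eqP; rewrite eqn_leq ltnNge leqnSn.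
  rewrite -(subnKC h) modnDl modn_small; last by have := ltn_ord i; lia.
  by lia.
have turn i : 0 < cross (V (ordS i) - V i) (V (ordS (ordS i)) - V i).
  exact: cvxV.
have Vneq i : V i != V (ordS i).
  by apply: contraTneq (turn i) => ->; rewrite subrr /cross /= !mul0r subrr ltxx.
have tan_ex i : exists z : R * R * R, [/\ V i = tangent_point c r z.1.1 (- z.1.2),
    V (ordS i) = tangent_point c r z.1.1 z.2 &
    (0 <= z.1.2 /\ 0 <= z.2) \/ (z.1.2 <= 0 /\ z.2 <= 0)].
  have [t [s [u h]]] := tangent_side_points r0 (Vneq i) (cirV i).
  by exists (t, s, u).
have [z zP] := choice tan_ex.
pose th i := (z i).1.1; pose s i := (z i).1.2; pose u i := (z i).2.
have Vl i : V i = tangent_point c r (th i) (- s i) by have [] := zP i.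
have Vr i : V (ordS i) = tangent_point c r (th i) (u i) by have [] := zP i.
have su0 i : [/\ 0 <= s i, 0 <= u i & 0 < s i + u i].
  have [_ _ h] := zP i; have [_ _ h'] := zP (ordS i).
  have E : tangent_point c r (th i) (u i) = tangent_point c r (th (ordS i)) (- s (ordS i)).
    by rewrite -Vr -Vl.
  by apply: (tangent_points_ge0 r0 E (Vr (ordS i)) h h'); rewrite -Vr -Vl.
(* Both tangent lengths from a vertex are determined by its distance to the centre. *)
have us i : u i = s (ordS i).
  have [_ u0 _] := su0 i; have [s0 _ _] := su0 (ordS i).
  have : r ^+ 2 * (1 + u i ^+ 2) = r ^+ 2 * (1 + s (ordS i) ^+ 2).
    rewrite -(edist_tangent_point_center c r (th i)) -Vr (Vl (ordS i)).
    by rewrite edist_tangent_point_center sqrrN.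
  move/(mulfI (lt0r_neq0 (exprn_gt0 2 r0))) => /addrI /eqP.
  by rewrite eqrXn2// => /eqP.
have sum_su : \sum_(i < m.+1) s i = \sum_(i < m.+1) u i.
  rewrite (reindex_inj (@ordS_inj m.+1)) /=.
  by apply: eq_bigr => i _; rewrite us.
have perE : perimeter V = 2 * r * \sum_(i < m.+1) u i.
  rewrite /perimeter (eq_bigr (fun i => r * (s i + u i))).
    by rewrite -mulr_sumr big_split /= sum_su; ring.
  move=> i _; rewrite Vl Vr edist_tangent_points ?ltW//.
  by have [? ? ?] := su0 i; rewrite opprK addrC ger0_norm// ltW.
(* The angle accumulated over [n] turns; it agrees with the [n]-th contact angle modulo [2 pi]. *)
pose A n := th ord0 + \sum_(k < n) atan (u (iter k (@ordS m.+1) ord0)) *+ 2.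
have AE n : cos (A n) = cos (th (iter n (@ordS m.+1) ord0)) /\
    sin (A n) = sin (th (iter n (@ordS m.+1) ord0)).
  elim: n => [|n [IHc IHs]]; first by rewrite /A big_ord0 addr0.
  set i := iter n _ _ in IHc IHs *.
  have -> : A n.+1 = A n + atan (u i) *+ 2 by rewrite /A big_ord_recr /= addrA.
  rewrite iterS -/i cosD sinD IHc IHs -cosD -sinD.
  have [|-> ->//] := @tangent_point_next c r (th i) (u i) (th (ordS i)) r0.
  by rewrite -Vr (Vl (ordS i)) us.
have AS : A m.+1 = th ord0 + (\sum_(i < m.+1) atan (u i)) *+ 2.
  rewrite /A sumrMnl; congr (_ + _ *+ 2); apply: eq_bigr => i _; congr (atan (u _)).
  by apply/val_inj; rewrite /= iter_ordS modn_small.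
have atan_ge0 i : 0 <= atan (u i).
  by rewrite -atan0; apply: le_atan; have [] := su0 i.
(* A zero total turn must be excluded before [cos_eq1_ge] applies: it would make all tangent lengths
   vanish. *)
have Spos : 0 < \sum_(i < m.+1) atan (u i).
  rewrite lt_neqAle sumr_ge0// andbT eq_sym; apply/eqP => S0.
  have u0 i : u i = 0.
    apply/eqP; rewrite -[u i]atanK -tan0; apply/eqP; congr tan; apply/eqP.
    by move/eqP: S0; rewrite psumr_eq0// => /allP/(_ i); rewrite mem_index_enum => /(_ isT).
  by have [_ _] := su0 ord0; rewrite -[ord0](@ord_predK m.+1) -us !u0 addr0 ltxx.
(* After all sides have been passed the contact point is the initial one, so the total turn has
   cosine 1. *)
have full : pi *+ 2 <= (\sum_(i < m.+1) atan (u i)) *+ 2.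
  apply: cos_eq1_ge; first by rewrite mulr2n addr_gt0.
  have [] := AE m.+1.
  have -> : iter m.+1 (@ordS m.+1) ord0 = ord0.
    by apply: ord_inj; rewrite iter_ordS modnn.
  rewrite AS; set S := _ *+ 2 => hc hs.
  have -> : S = th ord0 + S - th ord0 by ring.
  by rewrite cosB hc hs -!expr2 cos2Dsin2.
have le_atan_u : \sum_(i < m.+1) atan (u i) <= \sum_(i < m.+1) u i.
  by apply: ler_sum => i _; apply: atan_le; have [] := su0 i.
rewrite perE; move: full; rewrite lerMn2r /=.
nra.
Qed.
End Circumscribed.

(** * The supremum and infimum of the perimeter ratios *)

Section CircleConstant.
Context {R : realType}.
Implicit Types (c : R * R) (r s t x : R).

Lemma pi_div_bounds m : (3 <= m)%N -> 0 < (pi / m%:R : R) < pi / 2.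
Proof.
move=> m3; have pi0 := @pi_gt0 R.
have m0 : 0 < m%:R :> R by rewrite ltr0n (leq_trans _ m3).
by rewrite divr_gt0//= ltr_pM2l// ltf_pV2 ?posrE// ltr_nat.
Qed.

(** Used with [h] and [- h], this places both ends of a side of the polygon of circumradius
    [r / cos h] on one tangent line. *)
Lemma polar_tangent_point c r h t : cos h != 0 ->
  polar c (r / cos h) (t + h) = tangent_point c r t (tan h).
Proof. by move=> h0; rewrite /polar /tangent_point cosD sinD /tan; congr pair; field. Qed.

(** Parameter [x] of the side has offset [s (2 x - 1)], and offset [y] is at distance
    [r sqrt (1 + y ^ 2)] from the centre, so the line meets the circle only at the midpoint. *)
Lemma tangent_side_tangent_points c r t s : 0 < r -> s != 0 ->
  tangent_side (tangent_point c r t (- s)) (tangent_point c r t s) c r.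
Proof.
move=> r0 s0.
have L x : tangent_point c r t (- s) +
    x *: (tangent_point c r t s - tangent_point c r t (- s)) =
    tangent_point c r t (s * (x *+ 2 - 1)).
  by rewrite /tangent_point; congr pair; rewrite /= /GRing.scale /=; ring.
have T0 : circle c r (tangent_point c r t 0).
  rewrite /circle /= -[RHS](ger0_norm (ltW r0)) -sqrtr_sqr.
  rewrite -[LHS]ger0_norm ?sqrtr_ge0// -[LHS]sqrtr_sqr; congr Num.sqrt.
  by rewrite edist_tangent_point_center expr0n addr0 mulr1.
have half : tangent_point c r t (s * (2^-1 *+ 2 - 1)) = tangent_point c r t 0.
  by congr tangent_point; field.
exists (tangent_point c r t 0).
  by exists 2^-1; [lra|rewrite L half].
apply/seteqP; split=> [p [[x ->]]|p ->]; last first.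
  by split=> //; exists 2^-1; rewrite L half.
rewrite L => /(congr1 (fun y => y ^+ 2)); rewrite edist_tangent_point_center.
rewrite -[RHS]mulr1 => /(mulfI (lt0r_neq0 (exprn_gt0 2 r0))).
by rewrite -[RHS]addr0 => /addrI /eqP; rewrite sqrf_eq0 => /eqP ->.
Qed.

Lemma circumscribed_ngon m c r : (3 <= m)%N -> 0 < r ->
  circumscribed (@ngon R m c (r / cos (pi / m%:R))) c r.
Proof.
move=> m3 r0 i; have /andP[h0 hpi] := pi_div_bounds m3.
set h := pi / m%:R in h0 hpi *.
have ch : 0 < cos h by apply: cos_gt0_pihalf; apply/andP; split; lra.
rewrite ngon_ordS /ngon -/h; set a := h *+ 2 * i%:R.
have -> : a + h *+ 2 = (a + h) + h by lra.
have {1}-> : a = (a + h) + - h by lra.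
rewrite -{1}(cosN h) !polar_tangent_point ?cosN ?gt_eqF// tanN.
apply: tangent_side_tangent_points => //.
by rewrite gt_eqF// divr_gt0// sin_gt0_pi//; lra.
Qed.

Lemma circle_constant_pi k : (3 <= k)%N -> circle_constant k (pi : R).
Proof.
move=> k3 c r r0; have pi0 := @pi_gt0 R.
have k0 : (0 < k)%N by exact: leq_trans k3.
have m3 n : (3 <= 2 ^ n * k)%N by rewrite (leq_trans k3)// leq_pmull// expn_gt0.
have r2 : 0 < 2 * r by rewrite mulr_gt0.
have large x : exists n, x < (2 ^ n * k)%:R.
  exists (Num.bound `|x|); apply: le_lt_trans (ler_norm x) _.
  apply: lt_le_trans (archi_boundP (normr_ge0 x)) _.
  by rewrite ler_nat (leq_trans (ltnW (ltn_expl _ (ltnSn 1))))// leq_pmulr.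
have hb n := pi_div_bounds (m3 n).
have cb n : 0 < cos (pi / (2 ^ n * k)%:R : R).
  have /andP[h0 hpi] := hb n; apply: cos_gt0_pihalf; apply/andP; split; lra.
have mh n : (2 ^ n * k)%:R * (pi / (2 ^ n * k)%:R) = pi :> R.
  by rewrite mulrC divfK// pnatr_eq0 -lt0n (leq_trans _ (m3 n)).
have inI n : inscribed_ratios k c r ((2 ^ n * k)%:R * sin (pi / (2 ^ n * k)%:R)).
  exists n, (ngon c r); split.
  - by apply: regular_ngon => //; exact: leq_trans (m3 n).
  - exact: inscribed_ngon.
  - rewrite perimeter_ngon ?(ltW r0) ?(leq_trans _ (m3 n))//.
    by rewrite mulrAC divff ?mul1r// gt_eqF.
have inC n : circumscribed_ratios k c r ((2 ^ n * k)%:R * tan (pi / (2 ^ n * k)%:R)).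
  exists n, (ngon c (r / cos (pi / (2 ^ n * k)%:R))); split.
  - by apply: regular_ngon; [exact: leq_trans (m3 n)|exact: divr_gt0].
  - exact: circumscribed_ngon.
  - rewrite perimeter_ngon ?(leq_trans _ (m3 n))//; last by rewrite divr_ge0// ltW.
    by rewrite /tan; field; rewrite !gt_eqF.
split; split.
- move=> _ [n [V [[cvxV _ _] insV ->]]].
  rewrite ler_pdivrMr//; have := perimeter_inscribed_le r0 cvxV insV; lra.
- move=> x ubx; rewrite leNgt; apply/negP => xpi.
  (* With [h = pi / m], the ratio [m sin h] is at least [m h (1 - h) = pi - pi ^ 2 / m], which
     exceeds [x] once [m > pi ^ 2 / (pi - x)]. *)
  have [n] := large (pi ^+ 2 / (pi - x)).
  rewrite ltr_pdivrMr ?subr_gt0// => big.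
  have := ubx _ (inI n); have := mh n; have /andP[h0 hpi] := hb n.
  set m : R := (2 ^ n * k)%:R in big *; set h := pi / m in h0 hpi *.
  have := @mulr_cos_le_sin R h; rewrite (ltW h0) hpi => /(_ isT).
  have := cos_ge_1B (ltW h0) => c1 c2 mhE le_x.
  have m0 : 0 < m by rewrite ltr0n (leq_trans _ (m3 n)).
  have : m * (h * (1 - h)) <= x.
    by apply: le_trans le_x; rewrite ler_pM2l// (le_trans _ c2)// ler_pM2l.
  rewrite mulrA mhE => le2.
  have : m * (pi * (1 - h)) <= m * x by rewrite ler_pM2l.
  have -> : m * (pi * (1 - h)) = m * pi - pi * (m * h) by ring.
  rewrite mhE; lra.
- move=> _ [n [V [[cvxV _ _] cirV ->]]].
  rewrite ler_pdivlMr//; have := le_perimeter_circumscribed (m3 n) r0 cvxV cirV; lra.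
- move=> x lbx; rewrite leNgt; apply/negP => xpi.
  (* From [x <= m tan h] and [m sin h <= pi] follows [x (1 - h) <= x cos h <= pi], that is
     [x - pi <= pi x / m], which fails for this [m]. *)
  have [n] := large (pi * x / (x - pi)).
  rewrite ltr_pdivrMr ?subr_gt0// => big.
  have := lbx _ (inC n); have := mh n; have /andP[h0 hpi] := hb n; have := cb n.
  set m : R := (2 ^ n * k)%:R in big *; set h := pi / m in h0 hpi *.
  have := cos_ge_1B (ltW h0); have := sin_le (ltW h0) => s1 c1 ch mhE.
  have m0 : 0 < m by rewrite ltr0n (leq_trans _ (m3 n)).
  rewrite /tan mulrA ler_pdivlMr// => le_x.
  have le1 : x * cos h <= pi by rewrite -mhE (le_trans le_x)// ler_pM2l.
  have le2 : x * (1 - h) <= pi by apply: le_trans le1; rewrite ler_pM2l//; lra.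
  have : m * (x * (1 - h)) <= m * pi by rewrite ler_pM2l.
  have -> : m * (x * (1 - h)) = m * x - x * (m * h) by ring.
  rewrite mhE; lra.
Qed.
End CircleConstant.

(** * The area of the disc by integration of vertical chords *)

Section Area.
Context {R : realType}.
Implicit Types (c : R * R) (r x : R).

Lemma continuous_cos_sqr : continuous (fun t : R => cos t ^+ 2 *+ 2).
Proof.
move=> t.
have -> : (fun t : R => cos t ^+ 2 *+ 2) =
    (fun t => cos t * cos t + cos t * cos t).
  by apply/funext => u; rewrite mulr2n.
by apply: cvgD; apply: cvgM; exact: continuous_cos.
Qed.

Lemma integral_cos_sqr :
  (\int[lebesgue_measure]_(t in `[(- (pi / 2))%R, (pi / 2)%R])
     (cos t ^+ 2 *+ 2)%:E = (pi : R)%:E)%E.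
Proof.
have pi0 := @pi_gt0 R.
pose F (t : R) : R := t + sin t * cos t.
have dF t : is_derive t (1:R) F (cos t ^+ 2 *+ 2).
  apply: is_derive_eq.
  rewrite /GRing.scale /=.
  have := cos2Dsin2 t; lra.
have cF : continuous F.
  by move=> t; apply/differentiable_continuous/derivable1_diffP; have [] := dF t.
rewrite (@continuous_FTC2 _ _ F).
- rewrite /F cosN cos_pihalf !mulr0 !addr0 -EFinB; congr (_ %:E); lra.
- lra.
- by apply: continuous_subspaceT; exact: continuous_cos_sqr.
- split.
  + by move=> t _; have [] := dF t.
  + by apply: cvg_at_right_filter; exact: cF.
  + by apply: cvg_at_left_filter; exact: cF.
- by move=> t _; rewrite derive1E derive_val.
Qed.

(** The case split is essential: [Num.sqrt] is 0 on negative numbers, so beyond the disc the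
    interval would be a single point instead of empty. *)
Lemma xsection_disc c r x :
  0 < r -> xsection (disc c r) x =
    if x \in `[c.1 - r, c.1 + r] then
      `[c.2 - Num.sqrt (r ^+ 2 - (x - c.1) ^+ 2),
        c.2 + Num.sqrt (r ^+ 2 - (x - c.1) ^+ 2)]%classic
    else set0.
Proof.
move=> r0; apply/seteqP.
have E y : xsection (disc c r) x y <-> (y - c.2) ^+ 2 <= r ^+ 2 - (x - c.1) ^+ 2.
  rewrite /xsection /= inE /disc /edist /dot /= -[X in _ <= X]gtr0_norm//.
  rewrite -sqrtr_sqr ler_psqrt ?nnegrE ?sqr_ge0 ?addr_ge0//.
  - by rewrite -!expr2; split; lra.
  - by rewrite -!expr2 sqr_ge0.
  - by rewrite -!expr2 sqr_ge0.
case: ifPn => [|xr].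
- rewrite in_itv/= => /andP[x1 x2].
  have d0 : 0 <= r ^+ 2 - (x - c.1) ^+ 2 by nra.
  have Q y : ((y - c.2) ^+ 2 <= r ^+ 2 - (x - c.1) ^+ 2) =
      (`|y - c.2| <= Num.sqrt (r ^+ 2 - (x - c.1) ^+ 2)).
    by rewrite -sqrtr_sqr ler_psqrt ?nnegrE ?sqr_ge0.
  by split=> y; rewrite E Q /= in_itv/= ler_distl.
- split=> y //; rewrite E => yr; move: xr; rewrite in_itv/= => /negP; apply.
  have : (x - c.1) ^+ 2 <= r ^+ 2 by have := sqr_ge0 (y - c.2); lra.
  by move=> h; apply/andP; split; nra.
Qed.

Lemma area_disc c r : 0 < r -> area (disc c r) = (pi * r ^+ 2)%:E.
Proof.
move=> r0; have pi0 := @pi_gt0 R.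
pose G x := Num.sqrt (r ^+ 2 - (x - c.1) ^+ 2) *+ 2.
have cG : continuous G.
  move=> x; pose q y := r ^+ 2 - (y - c.1) * (y - c.1).
  have -> : G = (fun y => Num.sqrt (q y) + Num.sqrt (q y)).
    by apply/funext => y; rewrite /G /q mulr2n expr2.
  have h : {for x, continuous (fun y => Num.sqrt (q y))}.
    apply: (@continuous_comp _ _ _ q Num.sqrt).
      apply: cvgB; first exact: cvg_cst.
      by apply: cvgM; apply: cvgB; [exact: cvg_id|exact: cvg_cst|exact: cvg_id|exact: cvg_cst].
    exact: sqrt_continuous.
  by apply: cvgD.
pose F (t : R) := c.1 + r * sin t.
have dF t : is_derive t (1:R) F (r * cos t).
  by apply: is_derive_eq; rewrite /GRing.scale /=; ring.
have cF : continuous F.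
  by move=> t; apply/differentiable_continuous/derivable1_diffP; have [] := dF t.
have F'E : derive1 F = fun t => r * cos t.
  by apply/funext => t; rewrite derive1E derive_val.
have cF' : continuous (derive1 F).
  by rewrite F'E => t; apply: cvgM; [exact: cvg_cst|exact: continuous_cos].
rewrite /area /product_measure1.
transitivity (\int[lebesgue_measure]_(x in `[(c.1 - r)%R, (c.1 + r)%R]) (G x)%:E)%E.
  rewrite [RHS]integral_mkcond; apply: eq_integral => x _ /=.
  rewrite patchE xsection_disc// mem_setE; case: ifPn => _; last by rewrite measure0.
  rewrite lebesgue_measure_itv/= lte_fin /G.
  set s := Num.sqrt _; have s0 : 0 <= s by exact: sqrtr_ge0.
  (* The measure of an interval is defined by cases on its ends being strictly ordered; in the other
     case the chord is a point and [s = 0]. *)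
  case: ifPn => [_|]; first by rewrite -EFinB; congr (_%:E); lra.
  by rewrite -leNgt => h; congr (_%:E); lra.
have -> : c.1 - r = F (- (pi / 2)) by rewrite /F sinN sin_pihalf; lra.
have -> : c.1 + r = F (pi / 2) by rewrite /F sin_pihalf; lra.
rewrite integration_by_substitution_increasing.
- rewrite F'E.
  (* The chord [2 r cos t] times the derivative [r cos t] of the substitution; [cos t] is
     nonnegative on this interval. *)
  transitivity (\int[lebesgue_measure]_(t in `[(- (pi / 2))%R, (pi / 2)%R])
      ((r ^+ 2)%R%:E * (cos t ^+ 2 *+ 2)%:E))%E.
    apply: eq_integral => t; rewrite inE/= in_itv/= => tpi.
    rewrite /= -EFinM; congr (_%:E); rewrite fctE /G /F/=.
    have -> : r ^+ 2 - (c.1 + r * sin t - c.1) ^+ 2 = (r * cos t) ^+ 2.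
      by rewrite [in RHS]exprMn cos2sin2; ring.
    rewrite sqrtr_sqr ger0_norm; first ring.
    by rewrite mulr_ge0 ?cos_ge0_pihalf// ltW.
  rewrite ge0_integralZl//.
  + by rewrite integral_cos_sqr -EFinM mulrC.
  + apply/measurable_EFinP; apply: measurable_funTS.
    by apply: continuous_measurable_fun; exact: continuous_cos_sqr.
  + by move=> t _; rewrite lee_fin mulrn_wge0// sqr_ge0.
  + by rewrite lee_fin sqr_ge0.
- lra.
- by move=> a b ha hb ab; rewrite /F ltrD2l ltr_pM2l// ltr_sin.
- by move=> t _; exact: cF'.
- by apply: cvgP; apply: cvg_at_right_filter; exact: cF'.
- by apply: cvgP; apply: cvg_at_left_filter; exact: cF'.
- split.
  + by move=> t _; have [] := dF t.
  + by apply: cvg_at_right_filter; exact: cF.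
  + by apply: cvg_at_left_filter; exact: cF.
- exact: continuous_subspaceT.
Qed.
End Area.

Theorem corollary1 (R : realType) (k : nat) (hk : (3 <= k)%N) :
  exists2 p : R, circle_constant k p &
    forall (c : R * R) (r : R), 0 < r -> area (disc c r) = (p * r ^+ 2)%:E.
Proof.
exists pi; first exact: circle_constant_pi.
by move=> c r; exact: area_disc.
Qed.
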